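(* Let $\mathfrak C$ be a left cancellative small category. The following are equivalent: (i) $I_l\,\bar\ltimes\,\Omega$ is effective; (ii) $\mathfrak C^{*,0}\,\bar\ltimes\,\Omega$ is effective; (iii) For all $\mathfrak v\in\mathfrak C^0$, $u\in\mathfrak v\mathfrak C^*\mathfrak v$ and $f_1,\dots,f_n\in\mathcal J$ with $f_i\subsetneq\mathfrak v\mathfrak C$ for all $1\le i\le n$: if $uz\in z\mathfrak C^*$ for all $z\in\mathfrak v\mathfrak C\setminus\bigcup_{i=1}^nf_i$, then $ux=x$ for all $x\in\mathfrak v\mathfrak C\setminus\bigcup_{i=1}^nf_i$.
   Context: $\mathfrak C$ denotes the set of morphisms, $\mathfrak C^0\subseteq\mathfrak C$ the identity morphisms (identified with objects), $\mathfrak d,\mathfrak t$ domain and target; $cd$ is defined iff $\mathfrak d(c)=\mathfrak t(d)$; left cancellative means $cx=cy\Rightarrow x=y$. For $S\subseteq\mathfrak C$, $cS=\{cs:s\in S,\mathfrak t(s)=\mathfrak d(c)\}$. $\mathfrak C^*$ is the set of invertible elements, $\mathfrak v\mathfrak C^*\mathfrak v$ the set of $u\in\mathfrak C^*$ with $\mathfrak t(u)=\mathfrak d(u)=\mathfrak v$, and $\mathfrak C^{*,0}=\{u\in\mathfrak C^*:\mathfrak t(u)=\mathfrak d(u)\}$. Each $c\in\mathfrak C$ gives the partial bijection $\mathfrak d(c)\mathfrak C\to c\mathfrak C$, $x\mapsto cx$, again denoted $c$; $I_l$ is the smallest semigroup of partial bijections of $\mathfrak C$ containing these and closed under inverses;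 $\mathcal J=\{\mathrm{dom}(s):s\in I_l\}$ is its semilattice of idempotents (product = intersection, order = inclusion). $\bar{\mathcal J}$ is the set of subsets $\varepsilon=e\setminus\bigcup_{i=1}^nf_i$ of $\mathfrak C$ with $e,f_1,\dots,f_n\in\mathcal J$, $f_i\subseteq e$. $\widehat{\mathcal J}$ is the space of non-zero multiplicative maps $\chi:\mathcal J\to\{0,1\}$ with $\chi(\emptyset)=0$ if $\emptyset\in\mathcal J$ (pointwise convergence). $\Omega\subseteq\widehat{\mathcal J}$ consists of those $\chi$ such that whenever $e=\bigcup_{i=1}^nf_i$ ($e,f_i\in\mathcal J$) and $\chi(e)=1$, then $\chi(f_i)=1$ for some $i$. For $\chi\in\Omega$ and $\varepsilon=e\setminus\bigcup f_i\in\bar{\mathcal J}$, put $\chi(\varepsilon)=1$ iff $\chi(e)=1$ and $\chi(f_i)=0$ for all $i$, and $\chi(\varepsilon)=0$ otherwise (well defined). $s\in I_l$ acts by $\chi\mapsto s.\chi=\chi(s^{-1}\cdot s)$ from $\Omega(s^{-1}s)=\{\chi\in\Omega:\chi(s^{-1}s)=1\}$ onto $\Omega(ss^{-1})$. $I_l\,\bar\ltimes\,\Omega$ is the groupoid of classes $[s,\chi]^{\bar\sim}$ with $s\in I_l$, $\chi\in\Omega(s^{-1}s)$, where $(s,\chi)\bar\sim(t,\psi)$ iff $\chi=\psi$ and there is $\varepsilon\in\bar{\mathcal J}$ with $\chi(\varepsilon)=1$ and $s\varepsilon=t\varepsilon$ (equality of restrictions to $\varepsilon$ as partial bijections); source $\chi$,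 range $s.\chi$, $[s,t.\chi]^{\bar\sim}[t,\chi]^{\bar\sim}=[st,\chi]^{\bar\sim}$; topology such that the sets $\{[s,\chi]^{\bar\sim}:\chi\in\Omega(s^{-1}s)\}$ are open and mapped homeomorphically onto $\Omega(s^{-1}s)$ by the source map. $\mathfrak C^{*,0}\,\bar\ltimes\,\Omega:=\{[u,\chi]^{\bar\sim}:u\in\mathfrak C^{*,0}\}$, an open subgroupoid. An étale groupoid $\mathcal G$ is effective if the interior of its isotropy subgroupoid equals $\mathcal G^{(0)}$. *)

(* Defs.v *)
From HB Require Import structures.
From mathcomp Require Import all_boot all_order.
From mathcomp Require Import generic_quotient.
From mathcomp Require Import all_classical.
From mathcomp Require Import topology.

Set Implicit Arguments.
Unset Strict Implicit.
Unset Printing Implicit Defensive.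

Local Open Scope classical_set_scope.
Local Open Scope quotient_scope.

Definition set_mk T (A : set T) (x : T) (Ax : A x) : A :=
  exist (fun x => x \in A) x (mem_set Ax).

Declare Scope category_scope.
Delimit Scope category_scope with cat.

(** A small category is given by its set of morphisms, objects being identified
    with identity morphisms. Composition is a total function, but [c ** d] is
    meaningful (and constrained) only when [cdom c = ctgt d]. *)

HB.mixin Record isSmallCategory T := {
  cdom : T -> T;
  ctgt : T -> T;
  ccomp : T -> T -> T;
  cdom_dom : forall c, cdom (cdom c) = cdom c;
  ctgt_dom : forall c, ctgt (cdom c) = cdom c;
  cdom_tgt : forall c, cdom (ctgt c) = ctgt c;
  ctgt_tgt : forall c, ctgt (ctgt c) = ctgt c;
  cdom_comp : forall c d, cdom c = ctgt d -> cdom (ccomp c d) = cdom d;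
  ctgt_comp : forall c d, cdom c = ctgt d -> ctgt (ccomp c d) = ctgt c;
  ccomp_dom : forall c, ccomp c (cdom c) = c;
  ccomp_tgt : forall c, ccomp (ctgt c) c = c;
  ccompA : forall b c d, cdom b = ctgt c -> cdom c = ctgt d ->
    ccomp b (ccomp c d) = ccomp (ccomp b c) d
}.

#[short(type="smallCategory")]
HB.structure Definition SmallCategory := {T of isSmallCategory T}.

Notation "c ** d" := (ccomp c d) (at level 40, left associativity) : category_scope.
Local Open Scope category_scope.

HB.mixin Record isLeftCancellative T & SmallCategory T := {
  ccompI : forall c x y : T, cdom c = ctgt x -> cdom c = ctgt y ->
    c ** x = c ** y -> x = y
}.

#[short(type="lcCategory")]
HB.structure Definition LeftCancellativeCategory :=
  {T of isLeftCancellative T & SmallCategory T}.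

Section CategorySets.
Variable C : smallCategory.
Implicit Types (c u v : C) (S : set C).

Definition identities : set C := [set v | cdom v = v].

Definition invertible : set C :=
  [set u | exists w, [/\ cdom u = ctgt w, cdom w = ctgt u,
                         u ** w = ctgt u & w ** u = cdom u]].

Definition lmul_set c S : set C :=
  [set y | exists s, [/\ S s, ctgt s = cdom c & y = c ** s]].

Definition loops_invertible : set C := invertible `&` [set u | ctgt u = cdom u].

Definition invertible_at v : set C :=
  invertible `&` [set u | ctgt u = v /\ cdom u = v].

End CategorySets.
Arguments identities : clear implicits.
Arguments invertible : clear implicits.
Arguments loops_invertible : clear implicits.

HB.mixin Record SmallCategory_isGroupoid T & SmallCategory T := {
  ginv : T -> T;
  cdom_inv : forall g : T, cdom (ginv g) = ctgt g;
  ctgt_inv : forall g : T, ctgt (ginv g) = cdom g;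
  ccompVg : forall g : T, ginv g ** g = cdom g;
  ccompgV : forall g : T, g ** ginv g = ctgt g
}.

#[short(type="groupoid")]
HB.structure Definition Groupoid :=
  {T of SmallCategory_isGroupoid T & SmallCategory T}.

(* The last two axioms say that the source map is a local homeomorphism onto
   the unit space, the latter carrying the relative topology. *)
HB.mixin Record Groupoid_isEtale T & Groupoid T & Topological T := {
  ginv_continuous : continuous (ginv : T -> T);
  ccomp_continuous : {within [set p : T * T | cdom p.1 = ctgt p.2],
    continuous (fun p : T * T => p.1 ** p.2)};
  cdom_continuous : continuous (cdom : T -> T);
  cdom_local_homeo : forall g : T, exists U : set T,
    [/\ open U, U g, {in U &, injective cdom} &
      forall W : set T, open W -> W `<=` U ->
        exists2 V : set T, open V & cdom @` W = V `&` identities T]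
}.

#[short(type="etaleGroupoid")]
HB.structure Definition EtaleGroupoid :=
  {T of Groupoid_isEtale T & Groupoid T & Topological T}.

Definition isotropy (G : groupoid) : set G := [set g | cdom g = ctgt g].
Arguments isotropy : clear implicits.

Definition effective (G : etaleGroupoid) : Prop :=
  (isotropy G)° = identities G.

Record openSubgroupoid (G : etaleGroupoid) := OpenSubgroupoid {
  subgroupoid_set :> set G;
  subgroupoid_open : open subgroupoid_set;
  subgroupoid_comp : forall g h, cdom g = ctgt h ->
    subgroupoid_set g -> subgroupoid_set h -> subgroupoid_set (g ** h);
  subgroupoid_inv : forall g, subgroupoid_set g -> subgroupoid_set (ginv g)
}.

Section OpenSubgroupoidTheory.
Variables (G : etaleGroupoid) (H : openSubgroupoid G).

(* [set_type] carries the relative topology. *)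
Definition subgroupoid_type := set_type H.
Local Notation sH := subgroupoid_type.
Local Notation Hs := (subgroupoid_set H).
Implicit Types (g h : sH).

HB.instance Definition _ := Topological.copy sH (set_type H).

Lemma subgroupoid_memP (x : sH) : Hs (\val x).
Proof. by case: x => x /= /set_mem. Qed.

Definition sub_mk (x : G) (Hx : Hs x) : sH := set_mk Hx.

Lemma subgroupoid_dom x : Hs x -> Hs (cdom x).
Proof.
move=> Hx; rewrite -ccompVg; apply: subgroupoid_comp => //.
  by rewrite cdom_inv.
exact: subgroupoid_inv.
Qed.

Lemma subgroupoid_tgt x : Hs x -> Hs (ctgt x).
Proof.
move=> Hx; rewrite -cdom_inv; apply: subgroupoid_dom; exact: subgroupoid_inv.
Qed.

Definition sub_dom g : sH := sub_mk (subgroupoid_dom (subgroupoid_memP g)).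
Definition sub_tgt g : sH := sub_mk (subgroupoid_tgt (subgroupoid_memP g)).
Definition sub_inv g : sH := sub_mk (subgroupoid_inv (subgroupoid_memP g)).
(* [g] is a junk value for non-composable pairs. *)
Definition sub_comp g h : sH :=
  match pselect (cdom (\val g) = ctgt (\val h)) with
  | left e => sub_mk (subgroupoid_comp e (subgroupoid_memP g) (subgroupoid_memP h))
  | right _ => g
  end.

Lemma sub_domE g h : sub_dom g = sub_tgt h -> cdom (\val g) = ctgt (\val h).
Proof. by move=> /(congr1 \val). Qed.

Lemma sub_compE g h : cdom (\val g) = ctgt (\val h) ->
  \val (sub_comp g h) = \val g ** \val h.
Proof. by rewrite /sub_comp; case: pselect. Qed.

Fact sub_dom_dom g : sub_dom (sub_dom g) = sub_dom g.
Proof. by apply: val_inj; exact: cdom_dom. Qed.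
Fact sub_tgt_dom g : sub_tgt (sub_dom g) = sub_dom g.
Proof. by apply: val_inj; exact: ctgt_dom. Qed.
Fact sub_dom_tgt g : sub_dom (sub_tgt g) = sub_tgt g.
Proof. by apply: val_inj; exact: cdom_tgt. Qed.
Fact sub_tgt_tgt g : sub_tgt (sub_tgt g) = sub_tgt g.
Proof. by apply: val_inj; exact: ctgt_tgt. Qed.
Fact sub_dom_comp g h :
  sub_dom g = sub_tgt h -> sub_dom (sub_comp g h) = sub_dom h.
Proof.
move=> /sub_domE e; apply: val_inj => /=; rewrite sub_compE //; exact: cdom_comp.
Qed.
Fact sub_tgt_comp g h :
  sub_dom g = sub_tgt h -> sub_tgt (sub_comp g h) = sub_tgt g.
Proof.
move=> /sub_domE e; apply: val_inj => /=; rewrite sub_compE //; exact: ctgt_comp.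
Qed.
Fact sub_comp_dom g : sub_comp g (sub_dom g) = g.
Proof.
apply: val_inj; rewrite sub_compE /=; first exact: ccomp_dom.
by rewrite ctgt_dom.
Qed.
Fact sub_comp_tgt g : sub_comp (sub_tgt g) g = g.
Proof.
apply: val_inj; rewrite sub_compE /=; first exact: ccomp_tgt.
by rewrite cdom_tgt.
Qed.
Fact sub_compA g h k : sub_dom g = sub_tgt h -> sub_dom h = sub_tgt k ->
  sub_comp g (sub_comp h k) = sub_comp (sub_comp g h) k.
Proof.
move=> /sub_domE e1 /sub_domE e2; apply: val_inj.
rewrite !sub_compE //; first exact: ccompA.
- by rewrite cdom_comp.
- by rewrite ctgt_comp.
Qed.

HB.instance Definition _ := isSmallCategory.Build sH
  sub_dom_dom sub_tgt_dom sub_dom_tgt sub_tgt_tgt sub_dom_comp sub_tgt_comp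
  sub_comp_dom sub_comp_tgt sub_compA.

Fact sub_dom_inv g : cdom (sub_inv g) = ctgt g.
Proof. by apply: val_inj; exact: cdom_inv. Qed.
Fact sub_tgt_inv g : ctgt (sub_inv g) = cdom g.
Proof. by apply: val_inj; exact: ctgt_inv. Qed.
Fact sub_compVg g : sub_inv g ** g = cdom g.
Proof. by apply: val_inj; rewrite sub_compE /= ?ccompVg ?cdom_inv. Qed.
Fact sub_compgV g : g ** sub_inv g = ctgt g.
Proof. by apply: val_inj; rewrite sub_compE /= ?ccompgV ?ctgt_inv. Qed.

HB.instance Definition _ := SmallCategory_isGroupoid.Build sH
  sub_dom_inv sub_tgt_inv sub_compVg sub_compgV.

Lemma sub_val_continuous : continuous (\val : sH -> G).
Proof. exact: (@initial_continuous sH G \val). Qed.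

Lemma sub_continuous (X : topologicalType) (x : X) (F : set_system X)
    (f : X -> sH) : Filter F ->
  \val (f y) @[y --> F] --> \val (f x) -> f y @[y --> F] --> f x.
Proof.
move=> FF fx A /= [_ [[B oB <-] Bfx BA]].
have := fx B (open_nbhs_nbhs (conj oB Bfx)).
by rewrite /= /nbhs /=; apply: filterS => y By; exact: BA.
Qed.

Fact sub_inv_continuous : continuous (ginv : sH -> sH).
Proof.
move=> g; apply: sub_continuous => [|A nA]; first exact: nbhs_filter.
exact: (sub_val_continuous (@ginv_continuous G (\val g) A nA)).
Qed.

Fact sub_dom_continuous : continuous (cdom : sH -> sH).
Proof.
move=> g; apply: sub_continuous => [|A nA]; first exact: nbhs_filter.
exact: (sub_val_continuous (@cdom_continuous G (\val g) A nA)).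
Qed.

Fact sub_comp_continuous : {within [set p : sH * sH | cdom p.1 = ctgt p.2],
  continuous (fun p : sH * sH => p.1 ** p.2)}.
Proof.
apply/subspace_continuousP => -[g h] /= e.
apply: (@sub_continuous _ (g, h) _ (fun p : sH * sH => p.1 ** p.2)) => /=.
have e' := sub_domE e.
rewrite sub_compE // => A nA.
have /subspace_continuousP/(_ (\val g, \val h) e' A nA) := @ccomp_continuous G.
rewrite /= /within /= => -[[P Q] /= [nP nQ] PQ].
exists (\val @^-1` P, \val @^-1` Q) => /=.
  by split; exact: sub_val_continuous.
move=> [g' h'] /= [Pg Qh] /sub_domE e1.
rewrite sub_compE //; exact: (PQ (_, _)).
Qed.

Fact sub_dom_local_homeo (g : sH) : exists U : set sH,
  [/\ open U, U g, {in U &, injective cdom} &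
    forall W : set sH, open W -> W `<=` U ->
      exists2 V : set sH, open V & cdom @` W = V `&` identities sH].
Proof.
have [U [oU Ug injU HU]] := cdom_local_homeo (\val g).
exists (\val @^-1` U); split => //.
- by exists U.
- move=> x y; rewrite !inE => Ux Uy /(congr1 \val) /= exy.
  by apply: val_inj; apply: injU => //; rewrite inE.
move=> _ [W oW <-] WU.
have [|//|V oV VE] := HU (W `&` Hs).
- exact: openI (subgroupoid_open H).
- by move=> x [Wx Hx]; exact: (WU (sub_mk Hx)).
exists (\val @^-1` V); first by exists V.
apply/seteqP; split => x /=.
  move=> [y Wy <-]; have : (V `&` identities G) (cdom (\val y)).
    rewrite -VE; exists (\val y) => //; split => //; exact: subgroupoid_memP.
  by move=> [? e]; split => //; apply: val_inj.
move=> [Vx /(congr1 \val) /= xid].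
have : (V `&` identities G) (\val x) by split.
rewrite -VE => -[y [Wy Hy] yx].
by exists (sub_mk Hy) => //; apply: val_inj.
Qed.

HB.instance Definition _ := Groupoid_isEtale.Build sH
  sub_inv_continuous sub_comp_continuous sub_dom_continuous sub_dom_local_homeo.

End OpenSubgroupoidTheory.

Coercion subgroupoid_as_etale (G : etaleGroupoid) (H : openSubgroupoid G) :
  etaleGroupoid := subgroupoid_type H.

(* A partial bijection is given by its graph: [s x y] means [s(x) = y]. *)
Record pbij (T : Type) := PBij {
  pgraph :> T -> T -> Prop;
  pgraph_fun : forall x y y', pgraph x y -> pgraph x y' -> y = y';
  pgraph_inj : forall x x' y, pgraph x y -> pgraph x' y -> x = x'
}.

HB.instance Definition _ T := gen_eqMixin (pbij T).
HB.instance Definition _ T := gen_choiceMixin (pbij T).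

Section PBij.
Variable T : Type.
Implicit Types s t : pbij T.

Lemma pbij_ext s t : (forall x y, s x y <-> t x y) -> s = t.
Proof.
case: s t => [s sf si] [t tf ti] /= st.
have e : s = t by apply/funext => x; apply/funext => y; apply/propext.
by case: _ / e tf ti => tf ti; congr PBij; exact: Prop_irrelevance.
Qed.

Definition pdom s : set T := [set x | exists y, s x y].

Program Definition pcomp s t : pbij T :=
  @PBij T (fun x z => exists2 y, t x y & s y z) _ _.
Next Obligation.
by move=> s t x y y' /= [z tz sz] [z' /(pgraph_fun tz) <-] /(pgraph_fun sz).
Qed.
Next Obligation.
by move=> s t x y y' /= [z tz sz] [z' + /(pgraph_inj sz) zz]; subst => /(pgraph_inj tz).
Qed.

Definition pinv s : pbij T :=
  @PBij T (fun x y => s y x)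
    (fun x y y' h h' => pgraph_inj h h') (fun x x' y h h' => pgraph_fun h h').

Program Definition pid (A : set T) : pbij T :=
  @PBij T (fun x y => A x /\ x = y) _ _.
Next Obligation. by move=> A x y y' /= [_ <-] [_ <-]. Qed.
Next Obligation. by move=> A x y y' /= [_ ->] [_ ->]. Qed.

Definition prestr s (A : set T) : pbij T := pcomp s (pid A).

Lemma prestrP s t A :
  prestr s A = prestr t A <-> forall x y, A x -> (s x y <-> t x y).
Proof.
split=> [e x y Ax|st].
  have /= : forall u v, prestr s A u v <-> prestr t A u v by rewrite e.
  move=> /(_ x y) [h1 h2]; split=> [sxy|txy].
    by case: h1 => [|z [_ <-]//]; exists x.
  by case: h2 => [|z [_ <-]//]; exists x.
apply: pbij_ext => x y /=; split=> -[z [Ax <-] h]; exists x => //.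
  exact/st.
exact/st.
Qed.

Lemma pdom_id A : pdom (pid A) = A.
Proof. by apply/seteqP; split=> x /=; [move=> [y []]|exists x]. Qed.

Lemma pid_dom s : pid (pdom s) = pcomp (pinv s) s.
Proof.
apply: pbij_ext => x y /=; split=> [[[z sxz] <-]|[z sxz syz]]; first by exists z.
by split; [exists z|exact: pgraph_inj sxz syz].
Qed.

Lemma pid_setI A B : pcomp (pid A) (pid B) = pid (A `&` B).
Proof.
apply: pbij_ext => x y /=; split=> [[z [? <-] []]|[[? ?] <-]] //.
by exists x.
Qed.

End PBij.

Section LeftInverseHull.
Variable C : lcCategory.

(* The map [cdom c C -> cC, x |-> cx]. *)
Program Definition lmul (c : C) : pbij C :=
  @PBij C (fun x y => ctgt x = cdom c /\ y = c ** x) _ _.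
Next Obligation. by move=> c x y y' /= [_ ->] [_ ->]. Qed.
Next Obligation.
by move=> c x y y' /= [e ->] [e']; apply: ccompI.
Qed.

Inductive Il : set (pbij C) :=
| Il_lmul c : Il (lmul c)
| Il_comp s t : Il s -> Il t -> Il (pcomp s t)
| Il_inv s : Il s -> Il (pinv s).

Definition J : set (set C) := [set pdom s | s in Il].

End LeftInverseHull.
Arguments Il : clear implicits.
Arguments J : clear implicits.

Section HullOperations.
Variable C : lcCategory.
Implicit Types (s t : Il C) (e f : J C).

Lemma IlP s : Il C (\val s).
Proof. by case: s => s /= /set_mem. Qed.

Definition ilcomp s t : Il C := set_mk (Il_comp (IlP s) (IlP t)).
Definition ilinv s : Il C := set_mk (Il_inv (IlP s)).
Definition illmul (c : C) : Il C := set_mk (Il_lmul c).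

Lemma Jdom_subproof s : J C (pdom (\val s)).
Proof. by exists (\val s) => //; exact: IlP. Qed.
Definition Jdom s : J C := set_mk (Jdom_subproof s).

Lemma JP e : J C (\val e).
Proof. by case: e => e /= /set_mem. Qed.

Lemma ilid_subproof e : Il C (pid (\val e)).
Proof.
have [s Is <-] := JP e; rewrite pid_dom; apply: Il_comp => //; exact: Il_inv.
Qed.
Definition ilid e : Il C := set_mk (ilid_subproof e).

Lemma Jmeet_subproof e f : J C (\val e `&` \val f).
Proof.
rewrite -[_ `&` _]pdom_id -pid_setI; exists (pcomp (pid (\val e)) (pid (\val f))) => //.
by apply: Il_comp; exact: ilid_subproof.
Qed.
Definition Jmeet e f : J C := set_mk (Jmeet_subproof e f).

(* The idempotent [s^-1 e s], by which [s] acts on characters. *)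
Definition Jconj s e : J C := Jdom (ilcomp (ilinv s) (ilcomp (ilid e) s)).

Lemma JconjP s e x : \val (Jconj s e) x <-> exists2 y, \val s x y & \val e y.
Proof.
split=> /= [[y [z [z' sz [ez <-]] _]]|[y sxy ey]]; first by exists z'.
by exists x; exists y => //; exists y.
Qed.

End HullOperations.

Section Characters.
Variable C : lcCategory.
Implicit Types (e f : J C).

Definition Jhat : set {ptws (J C) -> bool} :=
  [set chi : {ptws (J C) -> bool} | [/\ exists e, chi e,
                 forall e f, chi (Jmeet e f) = chi e && chi f &
                 forall e, \val e = set0 -> chi e = false]].

Definition Omega : set {ptws (J C) -> bool} :=
  Jhat `&` [set chi : {ptws (J C) -> bool} | forall e n (f : 'I_n -> J C),
    \val e = \bigcup_i \val (f i) -> chi e -> exists i, chi (f i)].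

Definition barJ_pres (eps : set C) e n (f : 'I_n -> J C) : Prop :=
  (forall i, \val (f i) `<=` \val e) /\ eps = \val e `\` \bigcup_i \val (f i).

Definition barJ : set (set C) :=
  [set eps | exists e n (f : 'I_n -> J C), barJ_pres eps e f].

End Characters.
Arguments Jhat : clear implicits.
Arguments Omega : clear implicits.
Arguments barJ : clear implicits.

Section CharacterTheory.
Variable C : lcCategory.
Implicit Types (e f : J C) (chi psi : Omega C) (s t : Il C) (eps : set C).

Definition char_at chi e : bool := (\val chi : {ptws (J C) -> bool}) e.

(* See [char_barE] for the independence of the presentation of [eps]. *)
Definition char_bar chi eps : Prop := exists e n (f : 'I_n -> J C),
  [/\ barJ_pres eps e f, char_at chi e & forall i, char_at chi (f i) = false].

Lemma OmegaP chi : Omega C (\val chi).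
Proof. by case: chi => chi /= /set_mem. Qed.

Lemma Omega_ext chi psi : char_at chi =1 char_at psi -> chi = psi.
Proof. by move=> e; apply: val_inj; apply/funext. Qed.

Lemma char_at_neq0 chi : exists e, char_at chi e.
Proof. by have [[]] := OmegaP chi. Qed.

Lemma char_atM chi e f : char_at chi (Jmeet e f) = char_at chi e && char_at chi f.
Proof. by have [[]] := OmegaP chi. Qed.

Lemma char_at_set0 chi e : \val e = set0 -> char_at chi e = false.
Proof. have [[_ _ +] _] := OmegaP chi; exact. Qed.

Lemma char_at_bigcup chi e n (f : 'I_n -> J C) :
  \val e = \bigcup_i \val (f i) -> char_at chi e -> exists i, char_at chi (f i).
Proof. have [_ +] := OmegaP chi; exact. Qed.

Lemma char_at_eq chi e f : \val e = \val f -> char_at chi e = char_at chi f.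
Proof. by move=> /val_inj ->. Qed.

Lemma char_at_le chi e f : \val e `<=` \val f -> char_at chi e -> char_at chi f.
Proof.
move=> ef; rewrite -(@char_at_eq _ (Jmeet e f)) ?char_atM; first by case/andP.
by rewrite /=; exact/setIidPl.
Qed.

Lemma char_at_cover chi a n (f : 'I_n -> J C) :
  \val a `<=` \bigcup_i \val (f i) -> char_at chi a -> exists i, char_at chi (f i).
Proof.
move=> af chia; have [||i] := @char_at_bigcup chi a _ (fun i => Jmeet a (f i)) => //.
  apply/seteqP; split=> [x ax|x [i _ []]//].
  by have [i _ fx] := af x ax; exists i.
by rewrite char_atM => /andP[_]; exists i.
Qed.

Lemma char_bar_le chi eps a b : char_bar chi eps ->
  eps `&` \val a `<=` \val b -> char_at chi a -> char_at chi b.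
Proof.
move=> [e [n [f [[fe ->] chie chif]]]] ab chia.
pose g (i : 'I_n.+1) := if unlift ord0 i is Some j then f j else b.
have [||i] := @char_at_cover chi (Jmeet e a) _ g.
- move=> x [ex ax]; have [[j _ fx]|nfx] := pselect ((\bigcup_i \val (f i)) x).
    by exists (lift ord0 j) => //; rewrite /g liftK.
  by exists ord0 => //; rewrite /g unlift_none; apply: ab.
- by rewrite char_atM chie.
- by rewrite /g; case: unliftP => [j|] _ //; rewrite chif.
Qed.

Lemma char_barE chi eps e n (f : 'I_n -> J C) : barJ_pres eps e f ->
  char_bar chi eps <-> char_at chi e /\ forall i, char_at chi (f i) = false.
Proof.
move=> pf; split=> [ceps|[? ?]]; last by exists e, n, f.
have [e0 [n0 [f0 [[fe0 ee0] ce0 cf0]]]] := ceps.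
have [fe ee] := pf.
have epse : eps `<=` \val e by rewrite ee => x [].
split=> [|i].
  by apply: (char_bar_le ceps _ ce0) => x [/epse].
apply/negP => cfi.
have [||j] := @char_at_cover chi (Jmeet (f i) e0) _ f0.
- move=> x [fx ex]; apply: contrapT => nfx.
  have : eps x by rewrite ee0.
  by rewrite ee => -[_]; apply; exists i.
- by rewrite char_atM cfi.
- by rewrite cf0.
Qed.

Lemma char_barJ chi eps : char_bar chi eps -> barJ C eps.
Proof. by move=> [e [n [f [? _ _]]]]; exists e, n, f. Qed.

Lemma char_bar_val chi e : char_at chi e -> char_bar chi (\val e).
Proof.
move=> ce; exists e, 0, (fun i => e); split; [split|done|by case].
  by move=> i x.
by apply/seteqP; split=> [x ex|x []//]; split=> // -[[]].
Qed.

Lemma char_bar_setI chi eps eps' :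
  char_bar chi eps -> char_bar chi eps' -> char_bar chi (eps `&` eps').
Proof.
move=> [e [n [f [[fe ->] ce cf]]]] [e' [n' [f' [[fe' ->] ce' cf']]]].
pose g (i : 'I_(n + n')) := match fintype.split i with
  | inl j => Jmeet (f j) (Jmeet e e') | inr j => Jmeet (f' j) (Jmeet e e') end.
exists (Jmeet e e'), (n + n'), g; split.
- split=> [i|]; first by rewrite /g; case: fintype.split => j x [].
  apply/seteqP; split=> x.
    move=> [[ex nf] [ex' nf']]; split=> // -[i _].
    rewrite /g; case: fintype.split => j [fx _]; [apply: nf|apply: nf'];
    by exists j.
  move=> [[ex ex'] nf]; split; split=> // -[j _ fx]; apply: nf.
    by exists (lshift n' j) => //; rewrite /g (unsplitK (inl _ j)).
  by exists (rshift n j) => //; rewrite /g (unsplitK (inr _ j)).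
- by rewrite char_atM ce.
- by move=> i; rewrite /g; case: fintype.split => j; rewrite char_atM ?cf ?cf'.
Qed.

End CharacterTheory.

Section Action.
Variable C : lcCategory.
Implicit Types (e f : J C) (chi psi : Omega C) (s t : Il C) (eps : set C).

Definition act_fun s chi : {ptws (J C) -> bool} := fun e => char_at chi (Jconj s e).

Lemma act_subproof s chi : char_at chi (Jdom s) -> Omega C (act_fun s chi).
Proof.
move=> h; split; first split.
- exists (Jdom (ilinv s)); rewrite /act_fun.
  rewrite (@char_at_eq _ _ _ (Jdom s)) //; apply/seteqP; split=> x.
    by move=> /JconjP[y sxy _]; exists y.
  by move=> [y sxy]; apply/JconjP; exists y => //; exists x.
- move=> e f; rewrite /act_fun -char_atM; apply: char_at_eq.
  apply/seteqP; split=> x.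
    by move=> /JconjP[y sxy [ey fy]]; split; apply/JconjP; exists y.
  move=> [/JconjP[y sxy ey] /JconjP[y' sxy' fy]]; apply/JconjP; exists y => //.
  by split=> //; rewrite (pgraph_fun sxy sxy').
- move=> e e0; apply: char_at_set0; apply/seteqP; split=> // x.
  by move=> /JconjP[y _]; rewrite e0.
- move=> e n f ef; apply: char_at_bigcup; apply/seteqP; split=> x.
    by move=> /JconjP[y sxy]; rewrite ef => -[i _ fy]; exists i => //; apply/JconjP; exists y.
  by move=> [i _ /JconjP[y sxy fy]]; apply/JconjP; exists y => //; rewrite ef; exists i.
Qed.

Definition act s chi (h : char_at chi (Jdom s)) : Omega C :=
  set_mk (act_subproof h).

Lemma actE s chi (h : char_at chi (Jdom s)) e :
  char_at (act h) e = char_at chi (Jconj s e).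
Proof. by []. Qed.

Lemma act_bar s chi (h : char_at chi (Jdom s)) eps : char_bar (act h) eps ->
  char_bar chi [set x | exists2 y, \val s x y & eps y].
Proof.
move=> [e [n [f [[fe ->] ce cf]]]]; exists (Jconj s e), n, (fun i => Jconj s (f i)).
split=> //; split.
  by move=> i x /JconjP[y sxy fy]; apply/JconjP; exists y => //; exact: fe fy.
apply/seteqP; split=> x.
  move=> [y sxy [ey nf]]; split; first by apply/JconjP; exists y.
  move=> [i _ /JconjP[y' sxy' fy']]; apply: nf; exists i => //.
  by rewrite (pgraph_fun sxy sxy').
move=> [/JconjP[y sxy ey] nf]; exists y => //; split=> // -[i _ fy].
by apply: nf; exists i => //; apply/JconjP; exists y.
Qed.

Lemma act_comp s t chi (h : char_at chi (Jdom t)) (k : char_at (act h) (Jdom s))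
    (l : char_at chi (Jdom (ilcomp s t))) : act l = act k.
Proof.
apply: Omega_ext => e; rewrite !actE; apply: char_at_eq.
apply/seteqP; split=> x /JconjP.
  move=> [z [y txy syz] ez]; apply/JconjP; exists y => //.
  by apply/JconjP; exists z.
move=> [y txy /JconjP[z syz ez]]; apply/JconjP; exists z => //.
by exists y.
Qed.

Lemma char_at_dom_comp s t chi (h : char_at chi (Jdom t)) :
  char_at chi (Jdom (ilcomp s t)) = char_at (act h) (Jdom s).
Proof.
rewrite actE; apply: char_at_eq; apply/seteqP; split=> x.
  by move=> [z [y txy syz]]; apply/JconjP; exists y => //; exists z.
by move=> /JconjP[y txy [z syz]]; exists z, y.
Qed.

Lemma act_id e chi (h : char_at chi (Jdom (ilid e))) : act h = chi.
Proof.
apply: Omega_ext => f; rewrite actE.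
have ce : char_at chi e by rewrite -(@char_at_eq _ _ (Jdom (ilid e))) //= pdom_id.
transitivity (char_at chi (Jmeet e f)); last by rewrite char_atM ce.
apply: char_at_eq; apply/seteqP; split=> x.
  by move=> /JconjP[y [ex <-] fx].
by move=> [ex fx]; apply/JconjP; exists x.
Qed.

Lemma char_at_dom_id e chi : char_at chi (Jdom (ilid e)) = char_at chi e.
Proof. by apply: char_at_eq; rewrite /= pdom_id. Qed.

Lemma char_at_dom_inv s chi (h : char_at chi (Jdom s)) :
  char_at (act h) (Jdom (ilinv s)).
Proof.
rewrite actE (@char_at_eq _ _ _ (Jdom s)) //; apply/seteqP; split=> x.
  by move=> /JconjP[y sxy _]; exists y.
by move=> [y sxy]; apply/JconjP; exists y => //; exists x.
Qed.

Lemma actK s chi (h : char_at chi (Jdom s)) (k : char_at (act h) (Jdom (ilinv s))) :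
  act k = chi.
Proof.
apply: Omega_ext => e; rewrite !actE.
transitivity (char_at chi (Jmeet (Jdom s) e)); last by rewrite char_atM h.
apply: char_at_eq; apply/seteqP; split=> x.
  move=> /JconjP[y sxy /JconjP[x' syx' ex']]; split; first by exists y.
  by rewrite (pgraph_inj sxy syx').
move=> [[y sxy] ex]; apply/JconjP; exists y => //; apply/JconjP; exists x => //.
Qed.

Definition germ_sim s chi t psi : Prop := chi = psi /\
  exists eps, [/\ barJ C eps, char_bar chi eps & prestr (\val s) eps = prestr (\val t) eps].

Lemma germ_simP s chi t psi : germ_sim s chi t psi <-> chi = psi /\
  exists2 eps, char_bar chi eps & forall x y, eps x -> (\val s x y <-> \val t x y).
Proof.
split=> -[-> [eps]].
  by move=> [_ ceps /prestrP]; split=> //; exists eps.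
by move=> ceps st; split=> //; exists eps; split=> //; [exact: char_barJ ceps|exact/prestrP].
Qed.

Lemma germ_sim_refl s chi : germ_sim s chi s chi.
Proof.
apply/germ_simP; split=> //; have [e ce] := char_at_neq0 chi.
by exists (\val e) => //; exact: char_bar_val.
Qed.

Lemma germ_sim_sym s chi t psi : germ_sim s chi t psi -> germ_sim t psi s chi.
Proof.
move=> /germ_simP[-> [eps ceps st]]; apply/germ_simP; split=> //.
by exists eps => // x y ex; split=> /(st _ _ ex).
Qed.

Lemma germ_sim_trans s chi t psi r phi :
  germ_sim s chi t psi -> germ_sim t psi r phi -> germ_sim s chi r phi.
Proof.
move=> /germ_simP[-> [eps ceps st]] /germ_simP[e [eps' ceps' tr]].
subst phi; apply/germ_simP; split=> //; exists (eps `&` eps'); first exact: char_bar_setI.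
by move=> x y [ex ex']; split=> [/(st _ _ ex)/(tr _ _ ex')|/(tr _ _ ex')/(st _ _ ex)].
Qed.

Lemma germ_sim_act s t chi (h : char_at chi (Jdom s)) (k : char_at chi (Jdom t)) :
  germ_sim s chi t chi -> act h = act k.
Proof.
move=> /germ_simP[_ [eps ceps st]]; apply: Omega_ext => e; rewrite !actE.
apply/idP/idP; apply: (char_bar_le ceps) => x [ex] /JconjP[y sxy ey];
by apply/JconjP; exists y => //; exact/st.
Qed.

End Action.

Section Germs.
Variable C : lcCategory.

Definition germ_rep :=
  {p : (Il C * Omega C)%type | char_at p.2 (Jdom p.1)}.

Definition germ_rel (p q : germ_rep) : bool :=
  `[< germ_sim (\val p).1 (\val p).2 (\val q).1 (\val q).2 >].

Lemma germ_rel_equiv : equiv_class_of germ_rel.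
Proof.
split=> [p|p q|q p r]; first by apply/asboolP; exact: germ_sim_refl.
  by apply/asboolP/asboolP; exact: germ_sim_sym.
by move=> /asboolP pq /asboolP qr; apply/asboolP; exact: germ_sim_trans pq qr.
Qed.
Canonical germ_equiv := EquivRelPack germ_rel_equiv.

Definition germ := {eq_quot germ_equiv}.
HB.instance Definition _ := Choice.on germ.

Implicit Types (e f : J C) (chi psi : Omega C) (s t : Il C) (eps : set C) (g : germ).

Definition germ_of s chi (h : char_at chi (Jdom s)) : germ :=
  \pi_germ (exist _ (s, chi) h : germ_rep).

Lemma germ_ofP g : exists s chi (h : char_at chi (Jdom s)), g = germ_of h.
Proof.
by elim/quotW: g => -[[s chi] h]; exists s, chi, h.
Qed.

Lemma germ_eqP s chi (h : char_at chi (Jdom s)) t psi (k : char_at psi (Jdom t)) :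
  germ_of h = germ_of k <-> germ_sim s chi t psi.
Proof. by split=> [/eqmodP/asboolP|] //= e; apply/eqmodP/asboolP. Qed.

End Germs.

Section GermGroupoid.
Variable C : lcCategory.
Implicit Types (e f : J C) (chi psi : Omega C) (s t : Il C) (eps : set C) (g : germ C).

Definition germ_hull g : Il C := (\val (repr g)).1.
Definition germ_source g : Omega C := (\val (repr g)).2.

Lemma germ_source_dom g : char_at (germ_source g) (Jdom (germ_hull g)).
Proof. exact: valP (repr g). Qed.

Lemma germ_ofK g : germ_of (germ_source_dom g) = g.
Proof.
rewrite -[RHS]reprK /germ_of; congr (\pi _); apply: val_inj => /=.
exact/esym/surjective_pairing.
Qed.

Lemma germ_repr s chi (h : char_at chi (Jdom s)) :
  germ_sim (germ_hull (germ_of h)) (germ_source (germ_of h)) s chi.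
Proof. by apply/(germ_eqP (germ_source_dom _) h); rewrite germ_ofK. Qed.

Lemma germ_source_of s chi (h : char_at chi (Jdom s)) : germ_source (germ_of h) = chi.
Proof. by have [] := germ_repr h. Qed.

Lemma germ_of_ext s chi (h : char_at chi (Jdom s)) t psi (k : char_at psi (Jdom t)) :
  chi = psi -> (forall x y, \val s x y <-> \val t x y) -> germ_of h = germ_of k.
Proof.
move=> e st; apply/germ_eqP/germ_simP; split=> //; exists (\val (Jdom s)) => //.
exact: char_bar_val.
Qed.

Lemma char_at_id e chi : char_at chi e -> char_at chi (Jdom (ilid e)).
Proof. by rewrite char_at_dom_id. Qed.

Definition germ_unit e chi (h : char_at chi e) : germ C := germ_of (char_at_id h).

Lemma germ_unitP e chi (h : char_at chi e) f psi (k : char_at psi f) :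
  germ_unit h = germ_unit k <-> chi = psi.
Proof.
split=> [/germ_eqP[]//|e1]; subst psi; apply/germ_eqP/germ_simP; split=> //.
exists (\val (Jmeet e f)); first by apply: char_bar_val; rewrite char_atM h.
by move=> x y [ex fx]; split=> -[_ <-].
Qed.

Definition germ_dom g : germ C := germ_unit (germ_source_dom g).
Definition germ_tgt g : germ C := germ_unit (char_at_dom_inv (germ_source_dom g)).
Definition germ_inv g : germ C := germ_of (char_at_dom_inv (germ_source_dom g)).

Lemma germ_comp_subproof g h : germ_source g = act (germ_source_dom h) ->
  char_at (germ_source h) (Jdom (ilcomp (germ_hull g) (germ_hull h))).
Proof. by move=> e; rewrite (char_at_dom_comp _ (germ_source_dom h)) -e germ_source_dom. Qed.

(* [g] is a junk value for non-composable pairs. *)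
Definition germ_comp g h : germ C :=
  match pselect (germ_source g = act (germ_source_dom h)) with
  | left e => germ_of (germ_comp_subproof e)
  | right _ => g
  end.

Lemma germ_act s chi (h : char_at chi (Jdom s)) :
  act (germ_source_dom (germ_of h)) = act h.
Proof.
have := germ_repr h; move: (germ_hull _) (germ_source _) (germ_source_dom _).
move=> t psi k e; have [e1 _] := e; subst psi; exact: germ_sim_act e.
Qed.

Lemma germ_domE s chi (h : char_at chi (Jdom s)) f (k : char_at chi f) :
  germ_dom (germ_of h) = germ_unit k.
Proof. by apply/germ_unitP; exact: germ_source_of. Qed.

Lemma germ_tgtE s chi (h : char_at chi (Jdom s)) f (k : char_at (act h) f) :
  germ_tgt (germ_of h) = germ_unit k.
Proof. by apply/germ_unitP; exact: germ_act. Qed.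

Lemma germ_invE s chi (h : char_at chi (Jdom s)) :
  germ_inv (germ_of h) = germ_of (char_at_dom_inv h).
Proof.
rewrite /germ_inv; apply/germ_eqP.
have := germ_repr h; have := germ_act h.
move: (germ_hull _) (germ_source _) (germ_source_dom _) => t psi k ea e.
have [e1 _] := e; subst psi.
have /germ_simP[_ [eps ceps ts]] := e.
apply/germ_simP; split=> //; rewrite ea.
exists [set y | exists2 x, \val (ilinv s) y x & eps x].
  by apply: (act_bar (h := char_at_dom_inv h)); rewrite actK.
move=> y x [x' /= sxy ex']; split=> [txy|sxy'].
  have txy' : \val t x' y by exact/(ts _ _ ex').
  by rewrite (pgraph_inj txy txy').
by rewrite (pgraph_inj sxy' sxy); exact/(ts _ _ ex').
Qed.

(* [[s, t.chi] [t, chi] = [st, chi]] *)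
Lemma germ_compE s psi (k : char_at psi (Jdom s)) t chi (h : char_at chi (Jdom t))
    (l : char_at chi (Jdom (ilcomp s t))) : psi = act h ->
  germ_comp (germ_of k) (germ_of h) = germ_of l.
Proof.
move=> e; subst psi; rewrite /germ_comp; case: pselect => [e|[]]; last first.
  by rewrite germ_source_of germ_act.
apply/germ_eqP; move: (germ_comp_subproof e) => _ {e}.
have := germ_repr k; have := germ_repr h.
move: (germ_hull _) (germ_source _) => t' chi'; move: (germ_hull _) (germ_source _) => s' psi'.
move=> /germ_simP[-> [eps ceps tt']] /germ_simP[e [eps' ceps' ss']].
subst psi'; apply/germ_simP; split=> //.
exists (eps `&` [set x | exists2 y, \val t x y & eps' y]).
  by apply: char_bar_setI => //; exact: act_bar ceps'.
move=> x z [ex [y txy ey]] /=; split=> -[y' txy' syz].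
  have {}txy' : \val t x y' by exact/(tt' _ _ ex).
  exists y' => //; move: (pgraph_fun txy txy') => e; subst y'; exact/(ss' _ _ ey).
exists y'; first exact/(tt' _ _ ex).
move: (pgraph_fun txy txy') => e; subst y'; exact/(ss' _ _ ey).
Qed.

Lemma germ_dom_tgtE s psi (k : char_at psi (Jdom s)) t chi (h : char_at chi (Jdom t)) :
  germ_dom (germ_of k) = germ_tgt (germ_of h) <-> psi = act h.
Proof.
rewrite (germ_domE k k) (germ_tgtE (char_at_dom_inv h)); exact: germ_unitP.
Qed.

Lemma germ_comp_ofP s psi (k : char_at psi (Jdom s)) t chi (h : char_at chi (Jdom t)) :
  psi = act h -> exists l : char_at chi (Jdom (ilcomp s t)),
    germ_comp (germ_of k) (germ_of h) = germ_of l.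
Proof.
move=> e; have l : char_at chi (Jdom (ilcomp s t)).
  by rewrite (char_at_dom_comp _ h) -e.
by exists l; exact: germ_compE.
Qed.

Fact germ_dom_dom g : germ_dom (germ_dom g) = germ_dom g.
Proof. exact: germ_domE. Qed.

Fact germ_tgt_dom g : germ_tgt (germ_dom g) = germ_dom g.
Proof.
rewrite {2}/germ_dom (germ_tgtE (f := Jdom (germ_hull g))).
  by rewrite act_id; exact: germ_source_dom.
by move=> h; apply/germ_unitP; exact: act_id.
Qed.

Fact germ_dom_tgt g : germ_dom (germ_tgt g) = germ_tgt g.
Proof. exact: germ_domE. Qed.

Fact germ_tgt_tgt g : germ_tgt (germ_tgt g) = germ_tgt g.
Proof. by have := germ_tgt_dom (germ_tgt g); rewrite germ_dom_tgt. Qed.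

Fact germ_dom_comp g h : germ_dom g = germ_tgt h -> germ_dom (germ_comp g h) = germ_dom h.
Proof.
have [s [psi [k ->]]] := germ_ofP g; have [t [chi [l ->]]] := germ_ofP h.
move=> /germ_dom_tgtE e; have [m ->] := germ_comp_ofP k e.
by rewrite (germ_domE m m) (germ_domE l m).
Qed.

Fact germ_tgt_comp g h : germ_dom g = germ_tgt h -> germ_tgt (germ_comp g h) = germ_tgt g.
Proof.
have [s [psi [k ->]]] := germ_ofP g; have [t [chi [l ->]]] := germ_ofP h.
move=> /germ_dom_tgtE e; subst psi; have [m ->] := germ_comp_ofP k (erefl _).
rewrite (germ_tgtE (char_at_dom_inv m)) (germ_tgtE (char_at_dom_inv k)).
by apply/germ_unitP; exact: act_comp.
Qed.

Fact germ_comp_dom g : germ_comp g (germ_dom g) = g.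
Proof.
have [s [chi [h ->]]] := germ_ofP g; rewrite (germ_domE h h).
have [|m ->] := germ_comp_ofP h (h := char_at_id h); first by rewrite act_id.
apply: germ_of_ext => // x y; split=> /= [[z [_ <-]]//|sxy].
by exists x => //; split=> //; exists y.
Qed.

Fact germ_comp_tgt g : germ_comp (germ_tgt g) g = g.
Proof.
have [s [chi [h ->]]] := germ_ofP g; rewrite (germ_tgtE (char_at_dom_inv h)).
have [//|m ->] := germ_comp_ofP (char_at_id (char_at_dom_inv h)) (h := h).
apply: germ_of_ext => // x y; split=> /= [[z sxz [_ <-]]//|sxy].
by exists y => //; split=> //; exists x.
Qed.

Fact germ_compA g h k : germ_dom g = germ_tgt h -> germ_dom h = germ_tgt k ->
  germ_comp g (germ_comp h k) = germ_comp (germ_comp g h) k.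
Proof.
have [s [psi [hs ->]]] := germ_ofP g; have [t [chi [ht ->]]] := germ_ofP h.
have [r [phi [hr ->]]] := germ_ofP k.
move=> /germ_dom_tgtE e1 /germ_dom_tgtE e2; subst psi; subst chi.
have [m1 ->] := germ_comp_ofP ht (erefl _).
have [m2 ->] := germ_comp_ofP hs (erefl _).
have [|m3 ->] := germ_comp_ofP hs (h := m1); first by rewrite (act_comp ht).
have [m4 ->] := germ_comp_ofP m2 (h := hr) (erefl _).
apply: germ_of_ext => // x z; split=> /=.
  by move=> [y [w rxw twy] syz]; exists w => //; exists y.
by move=> [w rxw [y twy syz]]; exists y => //; exists w.
Qed.

HB.instance Definition _ := isSmallCategory.Build (germ C)
  germ_dom_dom germ_tgt_dom germ_dom_tgt germ_tgt_tgt germ_dom_comp germ_tgt_comp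
  germ_comp_dom germ_comp_tgt germ_compA.

Fact germ_dom_inv g : cdom (germ_inv g) = ctgt g.
Proof.
have [s [chi [h ->]]] := germ_ofP g; rewrite germ_invE /cdom /ctgt /=.
rewrite (germ_domE _ (char_at_dom_inv h)); exact/esym/germ_tgtE.
Qed.

Fact germ_tgt_inv g : ctgt (germ_inv g) = cdom g.
Proof.
have [s [chi [h ->]]] := germ_ofP g; rewrite germ_invE /cdom /ctgt /=.
rewrite (germ_tgtE (char_at_dom_inv (char_at_dom_inv h))) (germ_domE h h).
by apply/germ_unitP; exact: actK.
Qed.

Fact germ_compVg g : germ_inv g ** g = cdom g.
Proof.
have [s [chi [h ->]]] := germ_ofP g; rewrite germ_invE /cdom /ccomp /=.
rewrite (germ_domE h h).
have [//|m ->] := germ_comp_ofP (char_at_dom_inv h) (h := h).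
apply: germ_of_ext => // x y; split=> /=.
  by move=> [z sxz syz]; split; [exists z|exact: pgraph_inj sxz syz].
by move=> [[z sxz] <-]; exists z.
Qed.

Fact germ_compgV g : g ** germ_inv g = ctgt g.
Proof.
have [s [chi [h ->]]] := germ_ofP g; rewrite germ_invE /ctgt /ccomp /=.
rewrite (germ_tgtE (char_at_dom_inv h)).
have [|m ->] := germ_comp_ofP h (h := char_at_dom_inv h); first by rewrite actK.
apply: germ_of_ext => // x y; split=> /=.
  by move=> [z szx szy]; split; [exists z|exact: pgraph_fun szx szy].
by move=> [[z sxz] <-]; exists z.
Qed.

HB.instance Definition _ := SmallCategory_isGroupoid.Build (germ C)
  germ_dom_inv germ_tgt_inv germ_compVg germ_compgV.

Lemma open_char_at e (E : set bool) : open [set chi : Omega C | E (char_at chi e)].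
Proof.
exists [set chi : {ptws (J C) -> bool} | E (chi e)] => //.
have /continuousP c : continuous (fun chi : {ptws (J C) -> bool} => chi e).
  exact: (@proj_continuous (J C) (fun=> bool) e).
exact: (c E (discrete_open _)).
Qed.

Lemma open_char_bar eps : barJ C eps -> open [set chi : Omega C | char_bar chi eps].
Proof.
move=> [e [n [f pf]]].
rewrite (_ : mkset _ = [set chi | char_at chi e] `&`
    [set chi | forall i, char_at chi (f i) = false]).
  apply: openI; first exact: (@open_char_at _ id).
  rewrite openE => chi cf; apply: (@filter_forall _ _ (fun i chi => char_at chi (f i) = false) (nbhs chi) (nbhs_filter chi)) => i.
  apply: open_nbhs_nbhs; split; last exact: cf.
  exact: (@open_char_at _ (fun b => b = false)).
by apply/seteqP; split=> chi /=; move=> /(char_barE _ pf).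
Qed.

Lemma open_act s (A : set (Omega C)) : open A ->
  open [set chi | exists h : char_at chi (Jdom s), A (act h)].
Proof.
move=> [B oB <-].
rewrite (_ : mkset _ = [set chi | char_at chi (Jdom s)] `&`
    (act_fun s : Omega C -> {ptws (J C) -> bool}) @^-1` B).
  apply: openI; first exact: (@open_char_at _ id).
  apply: open_comp oB => chi _.
  apply/cvg_sup; first exact/fmap_filter/nbhs_filter.
  move=> e; move: chi; apply/(@continuousP _ (initial_topology (@^~ e))) => D [E oE <-].
  exact: (@open_char_at (Jconj s e) E).
apply/seteqP; split=> chi /=; first by move=> [h Bh].
by move=> [h Bh]; exists h.
Qed.

Definition bisection s (A : set (Omega C)) : set (germ C) :=
  [set g | exists chi (h : char_at chi (Jdom s)), A chi /\ g = germ_of h].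

(* [W] is open iff its trace on each [bisection s setT] is, in the coordinate
   [chi]. See [open_bisection], [germ_source_continuous] and
   [bisection_homeo] for the properties that characterize this topology. *)
Definition germ_open (W : set (germ C)) : Prop := forall s,
  open [set chi | exists h : char_at chi (Jdom s), W (germ_of h)].

Fact germ_openT : germ_open setT.
Proof.
move=> s; rewrite (_ : mkset _ = [set chi | char_at chi (Jdom s)]).
  exact: (@open_char_at _ id).
by apply/seteqP; split=> chi /= => [[]//|h]; exists h.
Qed.

Fact germ_openI : setI_closed germ_open.
Proof.
move=> A B oA oB s; have := openI (oA s) (oB s); congr open.
apply/seteqP; split=> chi /=.
  by move=> [[h Ah] [k Bk]]; exists h; split=> //; rewrite (bool_irrelevance h k).
by move=> [h [Ah Bh]]; split; exists h.
Qed.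

Fact germ_open_bigU (I : Type) (F : I -> set (germ C)) :
  (forall i, germ_open (F i)) -> germ_open (\bigcup_i F i).
Proof.
move=> oF s; have := bigcup_open (fun i (_ : setT i) => oF i s); congr open.
apply/seteqP; split=> chi /=.
  by move=> [i _ [h Fh]]; exists h, i.
by move=> [h [i _ Fh]]; exists i => //; exists h.
Qed.

HB.instance Definition _ :=
  isOpenTopological.Build (germ C) germ_openT germ_openI germ_open_bigU.

Lemma germ_openE (W : set (germ C)) : open W = germ_open W.
Proof. by []. Qed.

Lemma germ_of_irr s chi (h k : char_at chi (Jdom s)) : germ_of h = germ_of k.
Proof. by congr germ_of; exact: bool_irrelevance. Qed.

Lemma open_bisection s (A : set (Omega C)) : open A -> open (bisection s A).
Proof.
move=> oA; rewrite germ_openE => t; rewrite openE => chi /= [h [psi [k [Apsi /germ_eqP]]]].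
move=> /germ_simP[e [eps ceps ts]]; subst psi.
have : nbhs chi ([set chi | char_at chi (Jdom s)] `&` [set chi | char_at chi (Jdom t)]
    `&` A `&` [set chi | char_bar chi eps]).
  apply: open_nbhs_nbhs; split=> //; apply: openI.
    by apply: openI => //; apply: openI; exact: (@open_char_at _ id).
  exact/open_char_bar/char_barJ/ceps.
rewrite /interior; apply: filterS => phi [[[ks kt] Aphi] ephi].
exists kt, phi, ks; split=> //; apply/germ_eqP/germ_simP; split=> //.
by exists eps.
Qed.

Lemma germ_source_continuous : continuous germ_source.
Proof.
apply/continuousP => A oA; rewrite germ_openE => s.
have := openI (@open_char_at (Jdom s) id) oA; congr open.
apply/seteqP; split=> chi /=.
  by move=> [h Ah]; exists h; rewrite /= germ_source_of.
by move=> [h]; rewrite germ_source_of => Ah; split.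
Qed.

(* The source map is a homeomorphism from [bisection s setT] onto its image. *)
Lemma bisection_homeo s :
  [/\ germ_source @` bisection s setT = [set chi | char_at chi (Jdom s)],
      {in bisection s setT &, injective germ_source} &
      forall W : set (germ C), open W -> W `<=` bisection s setT ->
        open (germ_source @` W)].
Proof.
split.
- apply/seteqP; split=> chi.
    by move=> [_ [psi [h [_ ->]]] <-]; rewrite germ_source_of.
  by move=> h; exists (germ_of h); [exists chi, h|exact: germ_source_of].
- move=> g h; rewrite !inE => -[chi [k [_ ->]]] [psi [l [_ ->]]].
  by rewrite !germ_source_of => e; subst psi; exact: germ_of_irr.
- move=> W oW Ws; have := oW s; congr open; apply/seteqP; split=> chi.
    by move=> [h Wh]; exists (germ_of h) => //; exact: germ_source_of.
  move=> [g Wg <-]; have [psi [h [_ e]]] := Ws g Wg; subst g.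
  by rewrite germ_source_of; exists h.
Qed.

Lemma germ_of_nbhs s chi (h : char_at chi (Jdom s)) (W : set (germ C)) :
  nbhs (germ_of h) W -> nbhs chi [set psi | exists k : char_at psi (Jdom s), W (germ_of k)].
Proof.
rewrite nbhsE => -[V [oV Vh] VW].
have : nbhs chi [set psi | exists k : char_at psi (Jdom s), V (germ_of k)].
  by apply: open_nbhs_nbhs; split; [exact: oV|exists h].
by apply: filterS => psi [k Vk]; exists k; exact: VW.
Qed.

Fact germ_inv_continuous : continuous (ginv : germ C -> germ C).
Proof.
apply/continuousP => W oW; rewrite germ_openE => s.
have := open_act s (oW (ilinv s)); congr open.
apply/seteqP; split=> chi /=.
  move=> [h [k Wk]]; exists h; rewrite /ginv /= germ_invE.
  by rewrite (germ_of_irr _ k).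
by move=> [h]; rewrite /ginv /= germ_invE => Wh; exists h; exists (char_at_dom_inv h).
Qed.

Fact germ_dom_continuous : continuous (cdom : germ C -> germ C).
Proof.
apply/continuousP => W oW; rewrite germ_openE => s.
have := openI (@open_char_at (Jdom s) id) (oW (ilid (Jdom s))); congr open.
apply/seteqP; split=> chi /=.
  move=> [h [k Wk]]; exists h; rewrite /cdom /= (germ_domE h h).
  by rewrite /germ_unit (germ_of_irr _ k).
move=> [h]; rewrite /cdom /= (germ_domE h h) => Wh; split=> //.
by exists (char_at_id h).
Qed.

Fact germ_comp_continuous : {within [set p : germ C * germ C | cdom p.1 = ctgt p.2],
  continuous (fun p : germ C * germ C => p.1 ** p.2)}.
Proof.
apply/subspace_continuousP => -[g h] /=.
have [s [psi [k ->]]] := germ_ofP g; have [t [chi [l ->]]] := germ_ofP h.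
rewrite {1}/cdom {1}/ctgt /= => /germ_dom_tgtE e.
have [m me] := germ_comp_ofP k e.
have me' : germ_of k ** germ_of l = germ_of m := me.
rewrite /from_subspace /= me' => W /germ_of_nbhs; rewrite nbhsE => -[A [oA Achi] AW].
rewrite /= /within /=.
exists (bisection s setT, bisection t A) => /=.
  split; apply: open_nbhs_nbhs; split.
  - exact/open_bisection/openT.
  - by exists psi, k.
  - exact: open_bisection.
  - by exists chi, l.
move=> [g' h'] /= [[psi' [k' [_ ->]]] [chi' [l' [Achi' ->]]]].
rewrite {1}/cdom {1}/ctgt /= => /germ_dom_tgtE e'.
have [m' Wm'] := AW _ Achi'.
by rewrite /ccomp /= (germ_compE k' m' e').
Qed.

Fact germ_dom_local_homeo g : exists U : set (germ C),
  [/\ open U, U g, {in U &, injective cdom} &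
    forall W : set (germ C), open W -> W `<=` U ->
      exists2 V : set (germ C), open V & cdom @` W = V `&` identities (germ C)].
Proof.
have [s [chi [h ->]]] := germ_ofP g.
have [_ inj im] := bisection_homeo s.
have domP (x y : germ C) : cdom x = cdom y <-> germ_source x = germ_source y.
  exact: germ_unitP.
exists (bisection s setT); split.
- exact/open_bisection/openT.
- by exists chi, h.
- by move=> x y xs ys /domP; exact: inj.
- move=> W oW Ws; have oS := im W oW Ws.
  exists (germ_source @^-1` (germ_source @` W)).
    by move/continuousP : germ_source_continuous; apply.
  apply/seteqP; split=> x /=.
    move=> [y Wy <-]; split; last exact: cdom_dom.
    by exists y => //; rewrite /cdom /= germ_source_of.
  by move=> [[y Wy yx] xid]; exists y => //; rewrite -xid; exact/domP.
Qed.

HB.instance Definition _ := Groupoid_isEtale.Build (germ C)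
  germ_inv_continuous germ_comp_continuous germ_dom_continuous germ_dom_local_homeo.

End GermGroupoid.

Section LoopSubgroupoid.
Variable C : lcCategory.

Definition germ_groupoid : etaleGroupoid := germ C.

Definition loop_germs : set germ_groupoid := [set g | exists u : C,
  loops_invertible C u /\
  exists chi (h : char_at chi (Jdom (illmul u))), g = germ_of h].

Fact loop_germs_open : open loop_germs.
Proof.
rewrite (_ : loop_germs =
  \bigcup_(u in loops_invertible C) bisection (illmul u) setT).
  by apply: bigcup_open => u _; exact/open_bisection/openT.
apply/seteqP; split=> g.
  by move=> [u [uC [chi [h ->]]]]; exists u => //; exists chi, h.
by move=> [u uC [chi [h [_ ->]]]]; exists u; split=> //; exists chi, h.
Qed.

Lemma char_at_inhabited chi (e : J C) : char_at chi e -> exists x, \val e x.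
Proof.
move=> ce; apply: contrapT => ne.
have /negP[] : ~~ char_at chi e; last by [].
rewrite char_at_set0 //; apply/seteqP; split=> // x ex; apply: ne; by exists x.
Qed.

Fact loop_germs_comp (g h : germ_groupoid) : cdom g = ctgt h ->
  loop_germs g -> loop_germs h -> loop_germs (g ** h).
Proof.
move=> + [u [[[u' [uu1 uu2 uu3 uu4]] ul] [psi [k gE]]]].
move=> + [v [[[v' [vv1 vv2 vv3 vv4]] vl] [chi [l hE]]]].
subst g h => /germ_dom_tgtE e; rewrite /= in ul vl.
have [m me] := germ_comp_ofP k e.
have uv : cdom u = ctgt v.
  have [x [z [y [xv yE] [yu _]]]] := char_at_inhabited m.
  by rewrite -yu yE ctgt_comp.
exists (u ** v); split.
  split; last by rewrite /= ctgt_comp // cdom_comp // ul uv vl.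
  exists (v' ** u').
  have vu' : cdom v' = ctgt u' by rewrite vv2 -uu1 uv.
  split.
  - by rewrite cdom_comp // ctgt_comp.
  - by rewrite cdom_comp // ctgt_comp.
  - rewrite ctgt_comp // ccompA ?cdom_comp // -(ccompA _ _ _ uv) // vv3 -uv ccomp_dom //.
  - rewrite cdom_comp // ccompA ?ctgt_comp ?cdom_comp // -(ccompA _ _ _ vu') ?uu2 //.
    by rewrite uu4 uv -vv2 ccomp_dom.
have m' : char_at chi (Jdom (illmul (u ** v))).
  rewrite -(@char_at_eq _ _ (Jdom (ilcomp (illmul u) (illmul v)))) //.
  apply/seteqP; split=> x.
    by move=> [z [y [xv _] _]]; exists ((u ** v) ** x); split=> //; rewrite cdom_comp.
  move=> [z [xv _]]; rewrite cdom_comp // in xv; exists (u ** (v ** x)), (v ** x) => //=.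
  by rewrite ctgt_comp.
exists chi, m'; rewrite /ccomp /= me; apply: germ_of_ext => // x z; split=> /=.
  move=> [y [xv ->] [_ ->]]; rewrite cdom_comp //; split=> //.
  exact: ccompA.
move=> [xv ->]; rewrite cdom_comp // in xv; exists (v ** x) => //.
by rewrite ctgt_comp // ccompA.
Qed.

Fact loop_germs_inv (g : germ_groupoid) : loop_germs g -> loop_germs (ginv g).
Proof.
move=> [u [[[u' [uu1 uu2 uu3 uu4]] ul] [chi [k ->]]]]; rewrite /= in ul.
exists u'; split.
  split; last by rewrite /= -uu1 uu2 ul.
  by exists u; split; rewrite // -?uu1 ?uu2.
have e x y : \val (ilinv (illmul u)) x y <-> \val (illmul u') x y.
  split=> /= -[xy ->].
    by rewrite ctgt_comp // uu2; split=> //; rewrite ccompA ?uu2 // uu4 -xy ccomp_tgt.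
  rewrite ctgt_comp ?uu1 //; split=> //.
  by rewrite ccompA // uu3 -uu2 -xy ccomp_tgt.
have m : char_at (act k) (Jdom (illmul u')).
  rewrite -(@char_at_eq _ _ (Jdom (ilinv (illmul u)))); first exact: char_at_dom_inv.
  by apply/seteqP; split=> x [y /e h]; exists y.
exists (act k), m; rewrite /ginv /= germ_invE; exact: germ_of_ext.
Qed.

Definition loop_germ_subgroupoid : openSubgroupoid germ_groupoid :=
  OpenSubgroupoid loop_germs_open loop_germs_comp loop_germs_inv.

End LoopSubgroupoid.

(* Main.v *)
Require Import Defs.
From mathcomp Require Import all_boot all_classical topology.

(** Every [x : C] defines a principal character [principal x], sending an
    element [e] of [J] to the truth value of [x \in e]. It lies in [Omega], and
    the action is [s . principal x = principal (s x)]. The elements of [J] are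
    right ideals, so [principal x = principal y] exactly when [y] is the
    product of [x] and an invertible element ([principal_inj] is the direction
    used). Moreover the sets of characters with value 1 at some [eps] in [barJ]
    form a basis of the topology of [Omega] ([nbhs_char_bar]). These facts turn
    effectiveness into algebra: near a germ at [chi] in the interior of the
    isotropy, every [x] in some [eps] with [chi(eps) = 1] satisfies
    [s x \in x C^*].

    The equivalences are proved as a cycle. Effectiveness passes from any étale
    groupoid to its open subgroupoids ([effective_openSubgroupoid]).

    If the germs of loops are effective, let [u] be a loop at [v] with
    [u z \in z C^*] for all [z] in [eps = vC \ \bigcup f_i]. Membership in an
    element of [J] is unchanged by right multiplication with an invertible
    element, so [u] fixes every character with value 1 at [eps]. Its germs there
    form an open subset of the isotropy and are therefore units; being a unit at
    [principal x] forces [u x = x] ([loop_rigid_of_effective]).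

    Conversely, suppose that [s x \in x C^*] for all [x] in
    [eps = e \ \bigcup f_i]. For such an [x] one has [s x = x u] with [u] a loop
    at [d(x)], and [s (x z) = x u z]. Cancelling [x] transports the hypothesis
    to [u] on the complement in [d(x)C] of the sets [x^-1 f_i], which are proper
    since [x] is in no [f_i]. The rigidity of loops, evaluated at [d(x)], gives
    [u = d(x)], hence [s x = x] ([loop_rigid_fix]). So every germ in the interior
    of the isotropy is a unit ([germ_effective]). *)

Set Implicit Arguments.
Unset Strict Implicit.
Unset Printing Implicit Defensive.

Local Open Scope classical_set_scope.
Local Open Scope category_scope.

(** * Effective étale groupoids *)

Section Effective.

(** The source map is locally injective, and [h] and [cdom h] have the same
    source; so [h] is a unit as soon as both lie in a small neighbourhood of a
    unit. *)
Lemma open_identities (G : etaleGroupoid) : open (identities G).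
Proof.
rewrite openE => g gid; have [U [oU Ug injU _]] := cdom_local_homeo g.
have nU : nbhs g U by exact: open_nbhs_nbhs.
have ncU : nbhs g (cdom @^-1` U).
  by apply: (@cdom_continuous G g); rewrite gid.
apply: filterS (filterI nU ncU) => h [Uh Uch].
by apply: injU; rewrite ?inE //; exact: cdom_dom.
Qed.

(** Units are isotropic and form an open set, so only one inclusion in the
    definition of effectiveness has content. *)
Lemma effectiveP (G : etaleGroupoid) : effective G <->
  forall W : set G, open W -> W `<=` isotropy G -> W `<=` identities G.
Proof.
split=> [<- W oW WI|H].
  by rewrite -open_subsetE.
apply/seteqP; split; first by apply: H; [exact: open_interior|exact: interior_subset].
rewrite -open_subsetE; last exact: open_identities.
by move=> g /= gid; rewrite /isotropy /= -[in RHS]gid ctgt_dom.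
Qed.

Lemma effective_openSubgroupoid (G : etaleGroupoid) (H : openSubgroupoid G) :
  effective G -> effective H.
Proof.
move=> /effectiveP effG; apply/effectiveP => _ [V oV <-] VI g Vg.
apply: val_inj; apply: (effG (V `&` H)).
- exact: openI (subgroupoid_open H).
- by move=> h [Vh Hh]; exact: (congr1 val (VI (sub_mk Hh) Vh)).
- by split=> //; exact: subgroupoid_memP.
Qed.

End Effective.

(** * Right ideals and rigidity of loops *)

Section Hull.
Variable C : lcCategory.
Implicit Types (c u v w x y z : C) (e f : J C) (s t : Il C).

(** Elements of the left inverse hull commute with right multiplication. *)
Lemma Il_equivariant (s : pbij C) x y : Il C s -> s x y ->
  cdom y = cdom x /\ forall z, ctgt z = cdom x -> s (x ** z) (y ** z).
Proof.
move=> Is; elim: Is x y => {s} [c|s t _ IHs _ IHt|s _ IHs] x y /=.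
- move=> [xc ->]; split; first by rewrite cdom_comp.
  by move=> z zx; rewrite ctgt_comp // ccompA.
- move=> [w /IHt[wx tz] /IHs[yw sz]]; split; first by rewrite yw.
  by move=> z zx; exists (w ** z); [exact: tz|apply: sz; rewrite wx].
- by move=> /IHs[xy sz]; split=> // z; rewrite xy; exact: sz.
Qed.

Lemma J_right_ideal e x z : ctgt z = cdom x -> \val e x -> \val e (x ** z).
Proof.
move=> zx; have [s Is <-] := JP e => -[y sxy].
by exists (y ** z); apply: (Il_equivariant Is sxy).2.
Qed.

Lemma J_mul_invertible e x y : lmul_set x (invertible C) y -> \val e y <-> \val e x.
Proof.
move=> [w [[w' [ww' w'w w1 w2]] wx ->]]; split; last exact: J_right_ideal.
move=> /(J_right_ideal (z := w')).
by rewrite cdom_comp // -ccompA // w1 wx ccomp_dom; apply.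
Qed.

Lemma val_Jdom_illmulE c x : \val (Jdom (illmul c)) x <-> ctgt x = cdom c.
Proof. by split=> [[y []]//|xc]; exists (c ** x). Qed.

Lemma mutual_multiples x y z w : ctgt z = cdom x -> y = x ** z ->
  ctgt w = cdom y -> x = y ** w -> lmul_set x (invertible C) y.
Proof.
move=> zx yE wy xE.
have yz : cdom y = cdom z by rewrite yE cdom_comp.
have xw : cdom x = cdom w by rewrite xE cdom_comp.
exists z; split=> //; exists w; split; rewrite ?wy ?zx //.
  apply: (@ccompI _ x); rewrite ?ctgt_comp ?ctgt_dom ?ccompA ?wy ?yz //.
  by rewrite -yE -xE ccomp_dom.
rewrite -yz; apply: (@ccompI _ y); rewrite ?ctgt_comp ?ctgt_dom ?ccompA ?zx ?xw //.
by rewrite -xE -yE ccomp_dom.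
Qed.

Lemma lmul_set_identity v x : identities C v -> lmul_set v setT x <-> ctgt x = v.
Proof.
move=> vid; split=> [[y [_ yv ->]]|xv]; first by rewrite ctgt_comp // -vid ctgt_dom.
by exists x; split; rewrite // ?vid // -xv ccomp_tgt.
Qed.

(** The algebraic condition on loops: an invertible loop [u] at [v] that moves
    every [z] outside finitely many proper constructible right ideals of [vC]
    only within [z C^*] fixes all these [z]. *)
Definition loop_rigid : Prop := forall v u n (f : 'I_n -> J C),
  identities C v -> invertible_at v u ->
  (forall i, \val (f i) `<` lmul_set v setT) ->
  (forall z, (lmul_set v setT `\` \bigcup_i \val (f i)) z ->
     lmul_set z (invertible C) (u ** z)) ->
  forall x, (lmul_set v setT `\` \bigcup_i \val (f i)) x -> u ** x = x.

(** Rigidity of loops extends to all elements of the left inverse hull. *)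
Lemma loop_rigid_fix s e n (f : 'I_n -> J C) : loop_rigid ->
  (forall x, (\val e `\` \bigcup_i \val (f i)) x ->
     exists2 y, \val s x y & lmul_set x (invertible C) y) ->
  forall x, (\val e `\` \bigcup_i \val (f i)) x -> \val s x x.
Proof.
move=> rigid sinv x [ex nfx]; have [y sxy [u [uinv ux yE]]] := sinv x (conj ex nfx).
subst y.
have [] := Il_equivariant (IlP s) sxy; rewrite cdom_comp // => du sxuz.
have vid : identities C (cdom x) by exact: cdom_dom.
suff uv : u ** cdom x = cdom x by move: sxy; rewrite -du ccomp_dom in uv; rewrite uv du ccomp_dom.
(* [f' i] is [x^-1 (f i)], a right ideal inside [d(x)C] that omits [d(x)]. *)
pose f' i := Jconj (illmul x) (f i).
have f'P i y : \val (f' i) y <-> ctgt y = cdom x /\ \val (f i) (x ** y).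
  split; first by move=> /JconjP[_ [yx ->] fy].
  by move=> [yx fy]; apply/JconjP; exists (x ** y).
have nf'x i : ~ \val (f' i) (cdom x).
  by move=> /f'P[_]; rewrite ccomp_dom => fx; apply: nfx; exists i.
apply: (rigid (cdom x) u n f') => //.
- move=> i; split; first by move=> y /f'P[yx _]; exact/lmul_set_identity.
  move=> sub; apply: (nf'x i); apply: sub; apply/lmul_set_identity => //.
  exact: ctgt_dom.
- move=> z [/(lmul_set_identity _ vid) zx nf'z].
  have uz : cdom u = ctgt z by rewrite zx.
  have exz : (\val e `\` \bigcup_i \val (f i)) (x ** z).
    split; first exact: J_right_ideal.
    by move=> [i _ fxz]; apply: nf'z; exists i => //; apply/f'P.
  have [y' sxzy' [w [winv wz y'E]]] := sinv _ exz.
  have e1 := pgraph_fun (sxuz z zx) sxzy'.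
  exists w; split=> //; first by rewrite wz cdom_comp.
  rewrite cdom_comp // in wz.
  apply: (@ccompI _ x); rewrite ?ctgt_comp //.
  by rewrite !ccompA // e1.
- split; first by apply/lmul_set_identity => //; exact: ctgt_dom.
  by move=> [i _ /nf'x].
Qed.

End Hull.

(** * Principal characters *)

Section PrincipalCharacters.
Variable C : lcCategory.
Implicit Types (x y : C) (e f : J C) (chi psi : Omega C) (s t : Il C) (eps : set C).

(** The principal character at [x], as a function on [J]. *)
Definition principal_fun x : {ptws (J C) -> bool} := fun e => `[< \val e x >].

Lemma principal_subproof x : Omega C (principal_fun x).
Proof.
split; first split.
- exists (Jdom (illmul (ctgt x))); apply/asboolP/val_Jdom_illmulE.
  by rewrite cdom_tgt.
- move=> e f; apply/asboolP/andP; first by move=> [? ?]; split; exact/asboolP.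
  by move=> [/asboolP ? /asboolP ?]; split.
- by move=> e e0; apply/asboolP; rewrite e0.
- by move=> e n f ef /asboolP; rewrite ef => -[i _ fx]; exists i; exact/asboolP.
Qed.

(** The principal character at [x], as a point of [Omega]. *)
Definition principal x : Omega C := set_mk (principal_subproof x).

Lemma principalP x e : reflect (\val e x) (char_at (principal x) e).
Proof. exact: asboolP. Qed.

Lemma principal_barP x eps : barJ C eps -> char_bar (principal x) eps <-> eps x.
Proof.
move=> [e [n [f pf]]]; rewrite (char_barE _ pf); have [_ ->] := pf.
split=> [[/principalP ex nf]|[ex nf]].
  by split=> // -[i _ /principalP]; rewrite nf.
by split=> [|i]; [exact/principalP|apply/negP => /principalP fx; apply: nf; exists i].
Qed.

Lemma act_principal s x y (h : char_at (principal x) (Jdom s)) :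
  \val s x y -> act h = principal y.
Proof.
move=> sxy; apply: Omega_ext => e; rewrite actE.
apply/principalP/principalP => [/JconjP[y' sxy' ey']|ey].
  by rewrite (pgraph_fun sxy sxy').
by apply/JconjP; exists y.
Qed.

(** Each of [x] and [y] lies in the principal right ideal of the other. *)
Lemma principal_inj x y : principal x = principal y -> lmul_set x (invertible C) y.
Proof.
move=> xy.
have mem (a b : C) : principal a = principal b -> exists2 z, ctgt z = cdom a & b = a ** z.
  move=> ab; have /principalP : char_at (principal b) (Jdom (ilinv (illmul a))).
    rewrite -ab; apply/principalP; exists (cdom a) => /=.
    by rewrite ctgt_dom ccomp_dom.
  by move=> [z [za ->]]; exists z.
have [z zx yE] := mem x y xy; have [w wy xE] := mem y x (esym xy).
exact: mutual_multiples zx yE wy xE.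
Qed.

End PrincipalCharacters.

(** * A basis of the character space *)

Section Topology.
Variable C : lcCategory.
Implicit Types (e f : J C) (chi psi : Omega C) (s t : Il C) (eps : set C).

Lemma char_bar_sub chi eps eps' : barJ C eps' -> eps `<=` eps' ->
  char_bar chi eps -> char_bar chi eps'.
Proof.
move=> [e' [n' [f' pf']]] sub ceps; apply/(char_barE _ pf').
have [fe' epsE'] := pf'; have [e [n [f [[fe epsE] ce cf]]]] := ceps.
split; first by apply: (char_bar_le ceps _ ce) => x [/sub]; rewrite epsE' => -[].
move=> i; apply/negP => cfi.
have [||j] := @char_at_cover _ chi (Jmeet (f' i) e) _ f; last by rewrite cf.
  move=> x [f'x ex]; apply: contrapT => nfx.
  have : eps' x by apply: sub; rewrite epsE.
  by rewrite epsE' => -[_]; apply; exists i.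
by rewrite char_atM cfi.
Qed.

(** The sets of characters with value 1 at some [eps] in [barJ] form a basis of
    the topology of pointwise convergence on [Omega]. *)
Lemma nbhs_char_bar chi (A : set (Omega C)) : nbhs chi A ->
  exists2 eps, char_bar chi eps & forall psi, char_bar psi eps -> A psi.
Proof.
(* [F] is the filter generated by these sets at [chi]; it converges to [chi]
   because evaluation at each [e] is eventually constant along it. *)
pose F := filter_from [set eps | char_bar chi eps]
  (fun eps => [set psi : Omega C | char_bar psi eps]).
have FF : Filter F.
  apply: filter_from_filter.
    by have [e ce] := char_at_neq0 chi; exists (\val e); exact: char_bar_val.
  move=> i j ci cj; exists (i `&` j); first exact: char_bar_setI.
  by move=> psi /= pij; split; apply: char_bar_sub pij; rewrite /=;
    try exact: char_barJ ci; try exact: char_barJ cj; move=> x [].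
suff Fchi : F --> chi by move=> /Fchi.
suff Fval : (\val psi : {ptws (J C) -> bool}) @[psi --> F] --> (\val chi : {ptws (J C) -> bool}).
  move=> B /= [_ [[D oD <-] Dchi DB]].
  have FD : F (\val @^-1` D) := Fval D (open_nbhs_nbhs (conj oD Dchi)).
  exact: filterS FD.
apply/cvg_sup => e B [_ [[E oE <-] Ee EB]].
suff : F [set psi | char_at psi e = char_at chi e].
  by apply: filterS => psi eqe; apply: EB; rewrite /= -/(char_at psi e) eqe.
case ce : (char_at chi e).
  exists (\val e); first exact: char_bar_val.
  move=> psi /= cpsi; have [e' [_ [_ [_ ce' _]]]] := cpsi.
  by rewrite /= (char_bar_le cpsi _ ce') // => x [].
(* If [chi e = 0], take any [e1] with [chi e1 = 1]: a character with value 1 at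
   [e1 \ e] has value 0 at [e]. *)
have [e1 ce1] := char_at_neq0 chi.
pose f (i : 'I_1) := Jmeet e1 e.
have pf : barJ_pres (\val e1 `\` \bigcup_i \val (f i)) e1 f by split=> // i x [].
exists (\val e1 `\` \bigcup_i \val (f i)).
  by apply/(char_barE _ pf); split=> // i; rewrite char_atM ce andbF.
move=> psi /= /(char_barE _ pf)[pe1 /(_ ord0)].
by rewrite char_atM pe1.
Qed.

End Topology.

(** * Effectiveness of the germ groupoids *)

Section Germs.
Variable C : lcCategory.
Implicit Types (chi : Omega C) (s : Il C) (eps : set C).

Lemma isotropy_germP s chi (h : char_at chi (Jdom s)) :
  isotropy (germ_groupoid C) (germ_of h) <-> chi = act h.
Proof. exact: (germ_dom_tgtE h h). Qed.

Lemma identities_germP s chi (h : char_at chi (Jdom s)) :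
  identities (germ_groupoid C) (germ_of h) <->
  exists2 eps, char_bar chi eps & forall x, eps x -> \val s x x.
Proof.
rewrite /identities /= /cdom /= (germ_domE h h); split.
  move=> /germ_eqP/germ_simP[_ [eps ceps ids]].
  exists (eps `&` \val (Jdom s)); first exact/char_bar_setI/char_bar_val.
  by move=> x [epsx sx]; exact/(ids _ _ epsx).
move=> [eps ceps fixs]; apply/germ_eqP/germ_simP; split=> //; exists eps => // x y epsx.
have sxx := fixs x epsx; split=> [[_ <-]//|sxy]; split; first by exists x.
exact: pgraph_fun sxx sxy.
Qed.

Lemma germ_effective : loop_rigid C -> effective (germ_groupoid C).
Proof.
move=> rigid; apply/effectiveP => W oW WI g Wg.
have [s [chi [h gE]]] := germ_ofP g; subst g.
have [eps ceps epsW] := nbhs_char_bar (germ_of_nbhs (open_nbhs_nbhs (conj oW Wg))).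
have [e [n [f [[fe epsE] ce cf]]]] := ceps.
apply/identities_germP; exists eps => // x.
rewrite epsE; apply: (loop_rigid_fix rigid) => {}x; rewrite -epsE => epsx.
have [k Wk] := epsW _ ((principal_barP x (char_barJ ceps)).2 epsx).
have /principalP[y sxy] := k; exists y => //; apply: principal_inj.
by rewrite -(act_principal k sxy); apply/isotropy_germP/WI.
Qed.

Lemma loop_rigid_of_effective : effective (loop_germ_subgroupoid C) -> loop_rigid C.
Proof.
move=> /effectiveP eff v u n f vid [uinv [tu du]] fv uz x epsx.
set eps := _ `\` _ in uz epsx.
pose e := Jdom (illmul u).
have eE : \val e = lmul_set v setT.
  by apply/seteqP; split=> y; rewrite lmul_set_identity // val_Jdom_illmulE du.
have pf : barJ_pres eps e f.
  by split=> [i|]; rewrite eE //; case: (fv i).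
have bJ : barJ C eps by exists e, n, f.
pose W := bisection (illmul u) [set chi : Omega C | char_bar chi eps].
have oW : open W by apply: open_bisection; exact: open_char_bar.
have ul : loops_invertible C u by split=> //=; rewrite tu du.
have WH : W `<=` @loop_germs C.
  by move=> g [chi [h [_ ->]]]; exists u; split=> //; exists chi, h.
have WI : W `<=` isotropy (germ_groupoid C).
  move=> g [chi [h [ceps ->]]]; apply/isotropy_germP/Omega_ext => a; rewrite actE.
  apply/idP/idP; apply: (char_bar_le ceps) => y [epsy].
    have yv : ctgt y = cdom u by case: epsy => /(lmul_set_identity _ vid); rewrite du.
    move=> ay; apply/JconjP; exists (u ** y) => //.
    exact/(J_mul_invertible _ (uz y epsy)).
  by move=> /JconjP[_ [_ ->]]; move/(J_mul_invertible _ (uz y epsy)).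
have pe y : eps y -> char_bar (principal y) eps by move=> ?; exact/principal_barP.
have k : char_at (principal x) e by apply/principalP; rewrite eE; case: epsx.
have Wk : W (germ_of k) by exists (principal x), k; split=> //; exact: pe.
have oWH : open (\val @^-1` W : set (loop_germ_subgroupoid C)) by exists W.
have WHI : \val @^-1` W `<=` isotropy (loop_germ_subgroupoid C).
  by move=> g Wg; apply: val_inj; exact: WI Wg.
have := eff _ oWH WHI (@sub_mk _ (loop_germ_subgroupoid C) _ (WH _ Wk)) Wk.
move=> /(congr1 \val)/= /identities_germP[eps' ceps' /(_ x)[]//].
by apply/(principal_barP x (char_barJ ceps')).
Qed.

End Germs.

Theorem theorem4p5 (C : lcCategory) :
  (effective (germ_groupoid C) <-> effective (loop_germ_subgroupoid C)) /\
  (effective (loop_germ_subgroupoid C) <->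
    forall (v u : C) (n : nat) (f : 'I_n -> J C),
      identities C v ->
      invertible_at v u ->
      (forall i, \val (f i) `<` lmul_set v setT) ->
      (forall z, (lmul_set v setT `\` \bigcup_i \val (f i)) z ->
         lmul_set z (invertible C) (u ** z)) ->
      forall x, (lmul_set v setT `\` \bigcup_i \val (f i)) x -> u ** x = x).
Proof.
have GH := @effective_openSubgroupoid _ (loop_germ_subgroupoid C).
have HR := @loop_rigid_of_effective C; have RG := @germ_effective C.
by split; split; [exact: GH | move=> /HR/RG | exact: HR | move=> /RG/GH].
Qed.
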